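(* For every prime number $p\geq 5$, $$\sum_{k=0}^{\frac{p-1}{2}}\binom{2k}{k}H_{k}\equiv \begin{cases} -q_{3} \pmod p & \text{if } p\equiv 1 \pmod 3,\\ q_{3} \pmod p & \text{if } p\equiv 2 \pmod 3,\end{cases}$$ and $$\sum_{k=1}^{\lfloor \frac{p-1}{4}\rfloor}\frac{1}{4^{k}}\binom{4k}{2k}\left(2H_{2k}-H_{k}\right)\equiv \begin{cases} -(-1)^{(p-1)/2}\frac{q_{3}}{2} \pmod p & \text{if } p\equiv 1 \pmod 6,\\ (-1)^{(p-1)/2}\frac{q_{3}}{2} \pmod p & \text{if } p\equiv 5 \pmod 6.\end{cases}$$
   Context: $H_n$ denotes the $n$-th harmonic number: $H_0=0$, $H_n=1+\frac12+\cdots+\frac1n$. For a prime $p$ and an integer $a$ not divisible by $p$, $q_a=(a^{p-1}-1)/p$ is the Fermat quotient. Congruences between rational numbers are understood for rationals whose denominators are coprime to $p$. *)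

(* Defs.v *)
From mathcomp Require Import all_boot all_order all_algebra.

Set Implicit Arguments.
Unset Strict Implicit.
Unset Printing Implicit Defensive.

Import Order.TTheory GRing.Theory Num.Theory.
Local Open Scope ring_scope.

Definition harmonic_number (n : nat) : rat := \sum_(1 <= i < n.+1) i%:R^-1.

(* Division in rat; the value is an integer when p is a prime not dividing a. *)
Definition fermat_quotient (p : nat) (a : int) : rat :=
  (a%:~R ^+ p.-1 - 1) / p%:R.

(* Congruence modulo p between rationals. It holds only when both sides have
   a denominator coprime to p, so a congruence also asserts p-integrality. *)
Definition eqmodq (p : nat) (x y : rat) : Prop :=
  [/\ coprimez p (denq x), coprimez p (denq y) & (p %| numq (x - y))%Z].

(* Main.v *)
(** Put n = (p-1)/2 and L(c) = sum_{1 <= j <= n} c^j / j. Modulo p one has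
    C(2k, k) = (-4)^k C(n, k), and induction on n gives
      sum_k C(n, k) x^k (sum_{i <= k} c^i / i)
        = sum_{1 <= j <= n} (1 + x)^(n-j) ((1 + c x)^j - 1) / j.
    With c = 1, x = -4 the first sum becomes (-3)^n L(1) - (-3)^n L(-1/3).
    Since 2 H_{2k} - H_k = sum_{i <= 2k} (1 - (-1)^i) / i, the second sum is the
    part of even index of such a sum at x = 2, and it becomes a combination of
    L(1) - L(-1/3) and L(1) - L(-3).
    As C(p, 2j) / p = - 1 / (2j) modulo p, these logarithmic sums are read off
    from E(a, b) = sum_j C(p, 2j) a^j b^(n-j) modulo p^2. Expanding
    (y + x)^p + (y - x)^p with x, y in {1, sqrt(-3)}, where (1 + sqrt(-3))^3 = -8,
    gives E(1, 1) = E(-3, 1) = 2^(p-1) and E(1, -3) = +- 2^(p-1), with the sign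
    + exactly when p = 1 modulo 3. The first equality yields L(1) = L(-3), and
    the last one also yields (-3)^n modulo p^2, hence the Fermat quotient of 3. *)

Require Import Defs.
From mathcomp Require Import all_boot all_order all_algebra.
From mathcomp Require Import algC ring zify.

Set Implicit Arguments.
Unset Strict Implicit.
Unset Printing Implicit Defensive.

Import Order.TTheory GRing.Theory Num.Theory.
Local Open Scope ring_scope.

(** * Residues of [p]-integral rationals *)

(** [x] is [p]-integral with residue [f], where [p] is the characteristic of [F]. *)
Definition reduces (F : fieldType) (x : rat) (f : F) : Prop :=
  exists a b : int,
    [/\ b%:~R != 0 :> F, x = a%:~R / b%:~R & f = a%:~R / b%:~R].

Lemma intr_neq0_int (F : fieldType) (b : int) :
  b%:~R != 0 :> F -> b%:~R != 0 :> rat.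
Proof. by apply: contra_neq => /eqP; rewrite intr_eq0 => /eqP->. Qed.

Lemma reduces_int (F : fieldType) (a : int) : reduces a%:~R (a%:~R : F).
Proof. by exists a, 1; rewrite !divr1 oner_neq0. Qed.

Lemma reduces_nat (F : fieldType) (m : nat) : reduces m%:R (m%:R : F).
Proof. exact: (reduces_int F m). Qed.

Lemma reducesD (F : fieldType) (x y : rat) (f g : F) :
  reduces x f -> reduces y g -> reduces (x + y) (f + g).
Proof.
move=> [a [b [b0 -> ->]]] [c [d [d0 -> ->]]].
exists (a * d + c * b), (b * d).
have b0' := intr_neq0_int b0; have d0' := intr_neq0_int d0.
by rewrite !rmorphD !rmorphM /= mulf_neq0 // !addf_div.
Qed.

Lemma reducesM (F : fieldType) (x y : rat) (f g : F) :
  reduces x f -> reduces y g -> reduces (x * y) (f * g).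
Proof.
move=> [a [b [b0 -> ->]]] [c [d [d0 -> ->]]].
by exists (a * c), (b * d); rewrite !rmorphM /= mulf_neq0 // !mulf_div.
Qed.

Lemma reducesN (F : fieldType) (x : rat) (f : F) :
  reduces x f -> reduces (- x) (- f).
Proof.
by move=> [a [b [b0 -> ->]]]; exists (- a), b; rewrite !rmorphN !mulNr.
Qed.

Lemma reducesV (F : fieldType) (x : rat) (f : F) :
  f != 0 -> reduces x f -> reduces x^-1 f^-1.
Proof.
move=> f0 [a [b [b0 -> fE]]]; exists b, a; rewrite fE !invf_div; split=> //.
by apply: contra_neq f0 => a0; rewrite fE a0 mul0r.
Qed.

Lemma reducesX (F : fieldType) (x : rat) (f : F) (m : nat) :
  reduces x f -> reduces (x ^+ m) (f ^+ m).
Proof.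
move=> xf; elim: m => [|m IH]; first exact: (reduces_nat F 1).
by rewrite !exprS; apply: reducesM.
Qed.

Lemma reduces_sum (F : fieldType) (m1 m2 : nat) (x : nat -> rat)
    (f : nat -> F) :
  (forall i, (m1 <= i < m2)%N -> reduces (x i) (f i)) ->
  reduces (\sum_(m1 <= i < m2) x i) (\sum_(m1 <= i < m2) f i).
Proof.
move=> xf; rewrite big_nat [X in reduces _ X]big_nat.
elim/big_rec2: _ => [|i g y im yg]; first exact: (reduces_nat F 0).
by apply: reducesD => //; apply: xf.
Qed.

Lemma intr_eq0_pchar (F : fieldType) (p : nat) (z : int) :
  p \in [pchar F] -> (z%:~R == 0 :> F) = (p %| z)%Z.
Proof.
move=> charF; rewrite dvdzE absz_nat (dvdn_pcharf charF).
by case: z => m //; rewrite NegzE rmorphN oppr_eq0 abszN.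
Qed.

Lemma coprimez_pchar (F : fieldType) (p : nat) (z : int) :
  p \in [pchar F] -> coprimez p z = (z%:~R != 0 :> F).
Proof.
move=> charF; rewrite (intr_eq0_pchar z charF) dvdzE coprimezE absz_nat.
by rewrite prime_coprime // (pcharf_prime charF).
Qed.

(** The lowest-terms denominator divides the denominator [b] of any fraction equal to [x], and [b]
    is prime to [p] because it is nonzero in [F]. *)
Lemma reduces_coprime (F : fieldType) (p : nat) (x : rat) (f : F) :
  p \in [pchar F] -> reduces x f -> coprimez p (denq x).
Proof.
move=> charF [a [b [b0 xE _]]].
have: (denq x %| b)%Z.
  have e : (numq x * b = a * denq x)%R.
    apply: (@intr_inj rat); rewrite !rmorphM /= numqE xE.
    by rewrite mulrAC mulfVK // (intr_neq0_int b0).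
  have : (denq x %| numq x * b)%Z by rewrite e dvdz_mull.
  by rewrite Gauss_dvdzr // coprimez_sym coprimezE; exact: coprime_num_den.
move/coprimez_dvdr; apply.
by rewrite -[coprimez _ _]/(coprimez p b) (coprimez_pchar b charF).
Qed.

(** The bridge from identities in [F] back to rational congruences: [x - y] has residue 0, so [p]
    divides the numerator of a fraction whose denominator is prime to [p]. *)
Lemma reduces_eqmodq (F : fieldType) (p : nat) (x y : rat) (f : F) :
  p \in [pchar F] -> reduces x f -> reduces y f -> eqmodq p x y.
Proof.
move=> charF xf yf; split; [exact: reduces_coprime xf|exact: reduces_coprime yf|].
have [a [b [b0 xyE]]] := reducesD xf (reducesN yf).
rewrite subrr => /esym/eqP; rewrite mulf_eq0 invr_eq0 (negPf b0) orbF => a0.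
have e : (numq (x - y) * b = a * denq (x - y))%R.
  apply: (@intr_inj rat); rewrite !rmorphM /= numqE xyE.
  by rewrite mulrAC mulfVK // (intr_neq0_int b0).
have : (p %| numq (x - y) * b)%Z.
  by rewrite e dvdz_mulr // -(intr_eq0_pchar a charF).
by rewrite Gauss_dvdzl // (coprimez_pchar b charF).
Qed.

(** * Truncated logarithms and binomial transforms *)

(** Truncation of the series of -log(1 - c); at [c = 1] it is the harmonic number. *)
Definition truncated_log (R : unitRingType) (c : R) (n : nat) : R :=
  \sum_(1 <= i < n.+1) c ^+ i / i%:R.

Lemma truncated_logS (R : unitRingType) (c : R) (n : nat) :
  truncated_log c n.+1 = truncated_log c n + c ^+ n.+1 / n.+1%:R.
Proof. by rewrite /truncated_log big_nat_recr. Qed.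

Lemma truncated_log0 (R : unitRingType) (c : R) : truncated_log c 0 = 0.
Proof. by rewrite /truncated_log big_geq. Qed.

Lemma reduces_harmonic_number (F : fieldType) (n : nat) :
  (forall i, (0 < i <= n)%N -> i%:R != 0 :> F) ->
  reduces (harmonic_number n) (truncated_log (1 : F) n).
Proof.
move=> nz; apply: reduces_sum => i i_n; rewrite expr1n mul1r.
by apply: reducesV (nz _ _) (reduces_nat F i).
Qed.

Lemma sum_pascal (R : pzRingType) (n : nat) (g : nat -> R) :
  \sum_(0 <= k < n.+2) 'C(n.+1, k)%:R * g k =
  \sum_(0 <= k < n.+1) 'C(n, k)%:R * (g k + g k.+1).
Proof.
rewrite big_nat_recl // bin0.
under eq_bigr do rewrite binS natrD mulrDl.
rewrite big_split /=.
under [RHS]eq_bigr do rewrite mulrDr.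
rewrite big_split /= addrA; congr (_ + _).
rewrite [in RHS]big_nat_recl // bin0; congr (_ + _).
by rewrite big_nat_recr //= bin_small // mul0r addr0.
Qed.

(** The integral of (1 + t)^n from 0 to [z], obtained algebraically from (n + 1) C(n, k) = (k + 1)
    C(n + 1, k + 1). *)
Lemma sum_binomial_div (F : fieldType) (n : nat) (z : F) :
  (forall i, (0 < i <= n.+1)%N -> i%:R != 0 :> F) ->
  \sum_(0 <= k < n.+1) 'C(n, k)%:R * (z ^+ k.+1 / k.+1%:R) =
  ((1 + z) ^+ n.+1 - 1) / n.+1%:R.
Proof.
move=> nz; apply/(canRL (mulfK (nz _ _))); rewrite ?leqnn //.
rewrite [1 + z]addrC exprD1n -(big_mkord predT (fun i => z ^+ i *+ 'C(n.+1, i))).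
rewrite [in RHS]big_nat_recl // bin0 expr0 mulr1n [1 + _]addrC addrK mulr_suml.
rewrite !big_nat; apply: eq_bigr => k /= k_n.
transitivity (z ^+ k.+1 * (n.+1 * 'C(n, k))%:R / k.+1%:R).
  by rewrite natrM; ring.
rewrite (mul_bin_diag n.+1) mulnC natrM mulrA mulfK ?mulr_natr //.
by apply: nz; lia.
Qed.

Lemma sum_binomial_truncated_log (F : fieldType) (c x : F) (n : nat) :
  (forall i, (0 < i <= n)%N -> i%:R != 0 :> F) ->
  \sum_(0 <= k < n.+1) 'C(n, k)%:R * (x ^+ k * truncated_log c k) =
  \sum_(1 <= j < n.+1) (1 + x) ^+ (n - j) * (((1 + c * x) ^+ j - 1) / j%:R).
Proof.
elim: n => [|n IH] nz.
  by rewrite big_nat1 big_geq // truncated_log0 !mulr0.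
(* Pascal's rule splits the sum for [n.+1] into 1 + x times the sum for [n], plus a sum without
   logarithms that equals the new term [j = n.+1]. *)
rewrite sum_pascal.
under eq_bigr => k _.
  have -> : x ^+ k * truncated_log c k + x ^+ k.+1 * truncated_log c k.+1 =
    (1 + x) * (x ^+ k * truncated_log c k) + (c * x) ^+ k.+1 / k.+1%:R.
    by rewrite truncated_logS exprMn exprS; ring.
  rewrite mulrDr mulrCA; over.
rewrite big_split /= -mulr_sumr IH; last by move=> i i_n; apply: nz; lia.
rewrite sum_binomial_div // [in RHS]big_nat_recr //= subnn mul1r.
congr (_ + _); rewrite mulr_sumr !big_nat; apply: eq_bigr => j j_n.
by rewrite mulrA -exprS -subSn //; lia.
Qed.

(** Both sides obey the same recurrence in [k]: (k + 1) C(2k + 2, k + 1) = 2 (2k + 1) C(2k, k), and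
    2k + 1 = -2 (n - k) in [F] for n = (p - 1)/2. *)
Lemma central_binomial_pchar (F : fieldType) (p k : nat) :
  p \in [pchar F] -> odd p -> (k <= p./2)%N ->
  'C(2 * k, k)%:R = (- 4%:R) ^+ k * 'C(p./2, k)%:R :> F.
Proof.
move=> charF p_odd; elim: k => [|k IH] k_p; first by rewrite !bin0 mul1r.
have k1_neq0 : k.+1%:R != 0 :> F.
  by rewrite -(dvdn_pcharf charF) gtnNdvd //; lia.
apply: (mulfI k1_neq0).
transitivity (2%:R * (2 * k).+1%:R * 'C(2 * k, k)%:R : F).
  rewrite -!natrM; congr _%:R.
  rewrite mulnS -(mul_bin_diag (2 * k).+2) -mulnA (mul_bin_down (2 * k).+1) /=.
  have -> : ((2 * k).+1 - k = k.+1)%N by lia.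
  by rewrite mulnA; congr (_ * _)%N; lia.
rewrite IH ?(ltnW k_p) // [RHS]mulrCA -[in RHS]natrM mul_bin_left natrM.
have -> : (2 * k).+1%:R = - 2%:R * (p./2 - k)%:R :> F.
  apply/eqP; rewrite -subr_eq0 mulNr opprK -natrM -natrD.
  have -> : ((2 * k).+1 + 2 * (p./2 - k) = p)%N by lia.
  by rewrite (pcharf0 charF).
by rewrite exprS; ring.
Qed.

(** * Even-index binomial sums and their exact values *)

Lemma sum_even_odd (V : nmodType) (n : nat) (g : nat -> V) :
  \sum_(0 <= m < n.*2) g m = \sum_(0 <= k < n) (g k.*2 + g k.*2.+1).
Proof.
elim: n => [|n IH]; first by rewrite !big_geq.
by rewrite doubleS !big_nat_recr //= IH addrA.
Qed.

(** The sum E(a, b) for p = 2n + 1. Only the squares a = x^2 and b = y^2 occur, so the value -3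
    makes sense over [int]. *)
Definition even_binomial_sum (R : pzRingType) (n : nat) (a b : R) : R :=
  \sum_(0 <= j < n.+1) 'C(n.*2.+1, j.*2)%:R * (a ^+ j * b ^+ (n - j)).

(** Odd powers of [x] cancel; the remaining powers of [y] have odd exponent, whence the factor
    [y]. *)
Lemma exprD_exprB_odd (R : comPzRingType) (x y : R) (n : nat) :
  (y + x) ^+ n.*2.+1 + (y - x) ^+ n.*2.+1 =
  2%:R * y * even_binomial_sum n (x ^+ 2) (y ^+ 2).
Proof.
rewrite exprDn exprBn -big_split /= -(big_mkord predT (fun i =>
  y ^+ (n.*2.+1 - i) * x ^+ i *+ 'C(n.*2.+1, i) +
  (-1) ^+ i * y ^+ (n.*2.+1 - i) * x ^+ i *+ 'C(n.*2.+1, i))).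
rewrite -doubleS sum_even_odd mulr_sumr !big_nat; apply: eq_bigr => j j_n.
rewrite -signr_odd -[(-1) ^+ j.*2.+1]signr_odd oddS odd_double.
rewrite -!exprM !mul2n subSn ?leq_double // exprS doubleB -mulr_natl.
rewrite -[X in _ + X + _]mulr_natl -[X in _ + (X + _)]mulr_natl.
by rewrite -[X in _ + (_ + X)]mulr_natl; ring.
Qed.

Lemma rmorph_even_binomial_sum (R S : pzRingType) (h : {rmorphism R -> S})
    (n : nat) (a b : R) :
  h (even_binomial_sum n a b) = even_binomial_sum n (h a) (h b).
Proof.
rewrite rmorph_sum; apply: eq_bigr => j _.
by rewrite !rmorphM !rmorphXn /= rmorph_nat.
Qed.

Lemma even_binomial_sum11 (n : nat) : even_binomial_sum n 1 1 = 4%:R ^+ n :> int.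
Proof.
have := exprD_exprB_odd (1 : int) 1 n.
rewrite subrr expr0n addr0 !expr1n mulr1 exprS -addn1 -mul2n exprM.
by move/(mulfI (isT : (2%:R : int) != 0))=> <-.
Qed.

Lemma even_binomial_sum_N3_1 (n : nat) :
  (n %% 3 != 1)%N -> even_binomial_sum n (- 3%:R) 1 = 4%:R ^+ n :> int.
Proof.
move=> n3; apply: (@intr_inj algC); rewrite rmorph_even_binomial_sum rmorphXn /=.
rewrite rmorphN rmorph1 !rmorph_nat.
(* The identity is moved to [algC] to have a square root of -3. There 1 + w and 1 - w are twice
   primitive sixth roots of unity, so their powers depend on 2n + 1 modulo 6 up to powers of 64. *)
pose w : algC := sqrtC (- 3%:R); have w2 : w ^+ 2 = - 3%:R by rewrite sqrtCK.
apply: (@mulfI _ 2%:R); first by rewrite pnatr_eq0.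
have := exprD_exprB_odd w 1 n; rewrite w2 expr1n mulr1 => <-.
have c1 : (1 + w) ^+ 3 = - 8%:R by ring: w2.
have c2 : (1 - w) ^+ 3 = - 8%:R by ring: w2.
have [q [->|->]] : exists q, n = (3 * q)%N \/ n = (3 * q).+2.
  by exists (n %/ 3)%N; lia.
- have e (z : algC) : z ^+ (3 * q).*2.+1 = ((z ^+ 3) ^+ 2) ^+ q * z.
    by rewrite -!exprM -exprSr; congr (_ ^+ _); lia.
  rewrite !e c1 c2 exprM.
  have -> : (- 8%:R) ^+ 2 = 4%:R ^+ 3 :> algC by ring.
  by ring.
have e (z : algC) :
    z ^+ (3 * q).+2.*2.+1 = ((z ^+ 3) ^+ 2) ^+ q * z ^+ 3 * z ^+ 2.
  by rewrite -!exprM -!exprD; congr (_ ^+ _); lia.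
rewrite !e c1 c2 [_ ^+ (3 * q).+2]exprSr [_ ^+ (3 * q).+1]exprSr exprM.
have -> : (- 8%:R) ^+ 2 = 4%:R ^+ 3 :> algC by ring.
by ring: w2.
Qed.

Lemma even_binomial_sum_1_N3 (n : nat) :
  (n %% 3 != 1)%N ->
  even_binomial_sum n 1 (- 3%:R) = (-1) ^+ (n %% 3 == 2)%N * 4%:R ^+ n :> int.
Proof.
move=> n3; apply: (@intr_inj algC); rewrite rmorph_even_binomial_sum.
rewrite rmorphM rmorph_sign rmorphXn /= rmorphN rmorph1 !rmorph_nat.
pose w : algC := sqrtC (- 3%:R); have w2 : w ^+ 2 = - 3%:R by rewrite sqrtCK.
apply: (@mulfI _ (2%:R * w)).
  by rewrite mulf_neq0 ?pnatr_eq0 // -sqrf_eq0 w2 oppr_eq0 pnatr_eq0.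
have := exprD_exprB_odd 1 w n; rewrite w2 expr1n => <-.
have c1 : (w + 1) ^+ 3 = - 8%:R by ring: w2.
(* The two cubes now have opposite signs, which produces the sign -1 when n = 2 modulo 3. *)
have c2 : (w - 1) ^+ 3 = 8%:R by ring: w2.
have [q [qE|qE]] : exists q, n = (3 * q)%N \/ n = (3 * q).+2.
  by exists (n %/ 3)%N; lia.
- have -> : (n %% 3 == 2)%N = false by lia.
  have e (z : algC) : z ^+ n.*2.+1 = ((z ^+ 3) ^+ 2) ^+ q * z.
    by rewrite -!exprM -exprSr; congr (_ ^+ _); lia.
  rewrite !e c1 c2 qE exprM.
  have -> : (- 8%:R) ^+ 2 = 4%:R ^+ 3 :> algC by ring.
  have -> : 8%:R ^+ 2 = 4%:R ^+ 3 :> algC by ring.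
  by ring.
have -> : (n %% 3 == 2)%N = true by lia.
have e (z : algC) :
    z ^+ n.*2.+1 = ((z ^+ 3) ^+ 2) ^+ q * z ^+ 3 * z ^+ 2.
  by rewrite -!exprM -!exprD; congr (_ ^+ _); lia.
rewrite !e c1 c2 qE [_ ^+ (3 * q).+2]exprSr [_ ^+ (3 * q).+1]exprSr exprM.
have -> : (- 8%:R) ^+ 2 = 4%:R ^+ 3 :> algC by ring.
have -> : 8%:R ^+ 2 = 4%:R ^+ 3 :> algC by ring.
by ring: w2.
Qed.

(** * Binomial coefficients modulo p^2 and the Fermat quotient of 3 *)

(** C(p - 1, k) + C(p - 1, k + 1) = C(p, k + 1) vanishes in [F], so the sign alternates. *)
Lemma binomial_pred_pchar (F : fieldType) (p k : nat) :
  p \in [pchar F] -> (k < p)%N -> 'C(p.-1, k)%:R = (-1) ^+ k :> F.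
Proof.
move=> charF; have p_gt0 := prime_gt0 (pcharf_prime charF).
elim: k => [|k IH] k_p; first by rewrite bin0.
have := prime_dvd_bin (pcharf_prime charF) (k_p : 0 < k.+1 < p)%N.
rewrite (dvdn_pcharf charF) -{1}(prednK p_gt0) binS natrD IH; last by lia.
by rewrite addr_eq0 => /eqP->; rewrite exprS mulN1r.
Qed.

Lemma binomial_div_pchar (F : fieldType) (p k : nat) :
  p \in [pchar F] -> (0 < k < p)%N ->
  ('C(p, k) %/ p)%:R = - (-1) ^+ k / k%:R :> F.
Proof.
move=> charF k_p; have p_pr := pcharf_prime charF.
have k_neq0 : k%:R != 0 :> F by rewrite -(dvdn_pcharf charF) gtnNdvd //; lia.
have /divnK dvd_bin := prime_dvd_bin p_pr k_p.
apply: (canRL (mulfK k_neq0)); rewrite -natrM.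
have -> : ('C(p, k) %/ p * k = 'C(p.-1, k.-1))%N.
  apply/eqP; rewrite -(eqn_pmul2r (prime_gt0 p_pr)) mulnAC dvd_bin.
  by rewrite [X in _ == X]mulnC mul_bin_diag mulnC; case: k k_p {k_neq0 dvd_bin}.
rewrite binomial_pred_pchar //; last by lia.
by case: k k_p {k_neq0 dvd_bin} => // k _; rewrite exprS mulN1r opprK.
Qed.

(** The term [j = 0] gives [b ^+ n]; every other coefficient is divisible by [p]. Knowing the
    residue of [t] amounts to knowing the sum modulo p^2. *)
Lemma even_binomial_sum_pchar (F : fieldType) (n : nat) (a b : int) :
  n.*2.+1 \in [pchar F] ->
  exists t : int, even_binomial_sum n a b = b ^+ n + n.*2.+1%:R * t /\
    2%:R * t%:~R =
    - \sum_(1 <= j < n.+1) a%:~R ^+ j * b%:~R ^+ (n - j) / j%:R :> F.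
Proof.
move=> charF; set p := n.*2.+1 in charF *.
exists (\sum_(1 <= j < n.+1) ('C(p, j.*2) %/ p)%:R * (a ^+ j * b ^+ (n - j))).
split.
  rewrite /even_binomial_sum big_ltn // bin0 subn0 !mul1r mulr_sumr.
  congr (_ + _); rewrite !big_nat; apply: eq_bigr => j j_n.
  rewrite [RHS]mulrA -natrM mulnC divnK //.
  by apply: prime_dvd_bin (pcharf_prime charF) _; lia.
rewrite rmorph_sum /= mulr_sumr -sumrN !big_nat; apply: eq_bigr => j j_n.
rewrite !rmorphM !rmorphXn /= rmorph_nat binomial_div_pchar //; last by lia.
have j_neq0 : j%:R != 0 :> F by rewrite -(dvdn_pcharf charF) gtnNdvd //; lia.
have two_neq0 : 2%:R != 0 :> F by rewrite -(dvdn_pcharf charF) gtnNdvd //; lia.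
rewrite -signr_odd odd_double -muln2 natrM; field.
by rewrite j_neq0 two_neq0.
Qed.

(** Here 9^n = 3^(p - 1), so [q] is the Fermat quotient of 3. It is kept as an integer because its
    residue requires 9^n modulo p^2. *)
Lemma fermat_quotient3_pchar (F : fieldType) (n : nat) :
  n.*2.+1 \in [pchar F] -> (n %% 3 != 1)%N ->
  exists q : int, [/\ 9%:R ^+ n - 1 = n.*2.+1%:R * q,
    truncated_log (- 3%:R : F) n = truncated_log 1 n &
    \sum_(1 <= j < n.+1)
      (- 3%:R) ^+ (n - j) * (((- 3%:R) ^+ j - 1) / j%:R : F) =
    - ((-1) ^+ (n %% 3 == 2)%N * q%:~R)].
Proof.
move=> charF n3.
have [t1 [t1E t1F]] := even_binomial_sum_pchar 1 1 charF.
have [t2 [t2E t2F]] := even_binomial_sum_pchar (- 3%:R) 1 charF.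
have [t3 [t3E t3F]] := even_binomial_sum_pchar 1 (- 3%:R) charF.
rewrite even_binomial_sum11 expr1n in t1E.
rewrite even_binomial_sum_N3_1 // expr1n in t2E.
rewrite even_binomial_sum_1_N3 // in t3E.
set eta : int := (-1) ^+ _ in t3E.
have eta2 : eta ^+ 2 = 1 by rewrite /eta sqrr_sign.
set p : int := n.*2.+1%:R in t1E t2E t3E *.
have p_neq0 : p != 0 by rewrite pnatr_eq0.
have pF : p%:~R = 0 :> F by rewrite rmorph_nat (pcharf0 charF).
have log1E : truncated_log 1 n = - (2%:R * t1%:~R) :> F.
  rewrite t1F opprK /truncated_log; apply: eq_bigr => j _.
  by rewrite !rmorph1 !expr1n mulr1.
have log3E : truncated_log (- 3%:R) n = - (2%:R * t2%:~R) :> F.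
  rewrite t2F opprK /truncated_log; apply: eq_bigr => j _.
  by rewrite rmorph1 expr1n mulr1 rmorphN rmorph_nat.
have t12 : t1 = t2.
  by apply/(mulfI p_neq0)/(addrI 1); rewrite -t1E -t2E.
(* From (-3)^n + p t3 = eta 4^n and 4^n = 1 + p t1; squaring eta + p t then gives the witness for
   [q]. *)
pose t := eta * t1 - t3.
have N3E : (- 3%:R) ^+ n = eta + p * t :> int.
  by rewrite /t mulrBr mulrCA addrA -{1}[eta]mulr1 -mulrDr -t1E t3E addrK.
exists (2%:R * eta * t + p * t ^+ 2); split.
- have -> : 9%:R = (- 3%:R) ^+ 2 :> int by [].
  by rewrite -exprM mulnC exprM N3E sqrrD eta2 exprMn; ring.
- by rewrite log3E log1E t12.
have N3F : (- 3%:R) ^+ n = (-1) ^+ (n %% 3 == 2)%N :> F.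
  have := congr1 (fun z : int => z%:~R : F) N3E.
  rewrite rmorphXn rmorphN rmorph_nat rmorphD rmorphM /= pF mul0r addr0 => ->.
  by rewrite rmorph_sign.
set e := (-1) ^+ _ in N3F *.
have e2 : e ^+ 2 = 1 by rewrite /e sqrr_sign.
(* The products (-3)^(n-j) (-3)^j / j sum to (-3)^n L(1), and the rest is the logarithmic sum of
   [t3]. Both sides become -2t, since [q] has residue 2 e t. *)
transitivity (e * truncated_log 1 n + 2%:R * t3%:~R).
  rewrite t3F -sumrN -N3F /truncated_log mulr_sumr -big_split !big_nat.
  apply: eq_bigr => j /= j_n; rewrite rmorph1 !expr1n mul1r rmorphN rmorph_nat.
  have -> : (- 3%:R) ^+ n = (- 3%:R) ^+ (n - j) * (- 3%:R) ^+ j :> F.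
    by rewrite -exprD subnK //; lia.
  by ring.
rewrite log1E rmorphD !rmorphM /= pF mul0r addr0 rmorph_nat.
by rewrite /t rmorphB rmorphM /= !rmorph_sign -/e; clearbody e; ring: e2.
Qed.

(** * Extraction of the even-index part *)

(** Both sides are twice the sum of the reciprocals of the odd numbers below 2k. *)
Lemma truncated_log_double (F : fieldType) (k : nat) :
  2%:R != 0 :> F ->
  2%:R * truncated_log 1 k.*2 - truncated_log 1 k =
  truncated_log 1 k.*2 - truncated_log (-1 : F) k.*2.
Proof.
move=> two_neq0; elim: k => [|k IH]; first by rewrite !truncated_log0 mulr0.
have odd_sign : (-1) ^+ k.*2.+1 = -1 :> F by rewrite -signr_odd /= odd_double.
rewrite doubleS !truncated_logS [(-1) ^+ _.+2]exprS odd_sign !expr1n -doubleS.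
move: IH; rewrite -[k.+1.*2]mul2n natrM invfM.
set x := truncated_log _ k.*2; set y := truncated_log _ k.
set z := truncated_log _ k.*2 => IH.
set u := k.+1%:R^-1; set v := k.*2.+1%:R^-1.
have -> : z = y - x by rewrite -[z](subKr x) -IH; ring.
by field.
Qed.

Lemma sum_binomial_alt_log (F : fieldType) (n : nat) (x : F) :
  (forall i, (0 < i <= n)%N -> i%:R != 0 :> F) ->
  \sum_(0 <= k < n.+1) 'C(n, k)%:R *
     (x ^+ k * (truncated_log 1 k - truncated_log (-1) k)) =
  \sum_(1 <= j < n.+1)
     (1 + x) ^+ (n - j) * (((1 + x) ^+ j - (1 - x) ^+ j) / j%:R).
Proof.
move=> nz; under eq_bigr do rewrite 2!mulrBr.
rewrite sumrB !sum_binomial_truncated_log // -sumrB; apply: eq_bigr => j _.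
by rewrite mul1r mulN1r; ring.
Qed.

(** Adding the sums at [x] and [- x] kills odd indices and doubles even ones. *)
Lemma sum_even_binomial_log (F : fieldType) (n : nat) (x : F) :
  2%:R != 0 :> F ->
  2%:R * \sum_(0 <= k < n./2.+1) 'C(n, k.*2)%:R *
     ((x ^+ 2) ^+ k * (2%:R * truncated_log 1 k.*2 - truncated_log 1 k)) =
  \sum_(0 <= k < n.+1) 'C(n, k)%:R *
     (x ^+ k * (truncated_log 1 k - truncated_log (-1) k)) +
  \sum_(0 <= k < n.+1) 'C(n, k)%:R *
     ((- x) ^+ k * (truncated_log 1 k - truncated_log (-1) k)).
Proof.
move=> two_neq0.
pose g k : F := 'C(n, k)%:R *
  ((x ^+ k + (- x) ^+ k) * (truncated_log 1 k - truncated_log (-1) k)).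
rewrite -big_split /= [RHS](_ : _ = \sum_(0 <= k < n.+1) g k); last first.
  by apply: eq_bigr => k _; rewrite /g -mulrDr -mulrDl.
(* For even [n] the paired range contains the extra index n + 1, where the binomial coefficient is
   0. *)
have -> : \sum_(0 <= k < n.+1) g k = \sum_(0 <= k < n./2.+1.*2) g k.
  rewrite (@big_cat_nat _ _ _ n.+1 0 n./2.+1.*2) //=; last by lia.
  rewrite [X in _ + X]big_nat [X in _ + X]big1 ?addr0 // => k k_n.
  by rewrite /g bin_small ?mul0r //; lia.
rewrite sum_even_odd mulr_sumr; apply: eq_bigr => k _.
rewrite /g truncated_log_double // [(- x) ^+ _]exprNn [(- x) ^+ _.+1]exprNn.
rewrite -[(-1) ^+ k.*2]signr_odd -[(-1) ^+ k.*2.+1]signr_odd /= odd_double.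
rewrite -exprM mul2n /=.
by ring.
Qed.

(** * Evaluation of the two sums in characteristic [p] *)

Lemma sum_central_binomial_log (F : fieldType) (n : nat) (q : F) :
  n.*2.+1 \in [pchar F] ->
  \sum_(1 <= j < n.+1)
      (- 3%:R) ^+ (n - j) * (((- 3%:R) ^+ j - 1) / j%:R) = q ->
  \sum_(0 <= k < n.+1) 'C(2 * k, k)%:R * truncated_log 1 k = q.
Proof.
move=> charF <-.
have nz i : (0 < i <= n)%N -> i%:R != 0 :> F.
  by move=> i_n; rewrite -(dvdn_pcharf charF) gtnNdvd //; lia.
transitivity (\sum_(0 <= k < n.+1)
    'C(n, k)%:R * ((- 4%:R) ^+ k * truncated_log (1 : F) k)).
  rewrite !big_nat; apply: eq_bigr => k /= k_n.
  rewrite (central_binomial_pchar charF) /= ?odd_double ?uphalf_double //.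
  by ring.
rewrite sum_binomial_truncated_log //; apply: eq_bigr => j _.
by rewrite mul1r; have -> : 1 - 4%:R = - 3%:R :> F by ring.
Qed.

Lemma sum_central_binomial4_log (F : fieldType) (n : nat) (q : F) :
  (2 < n.*2.+1)%N -> n.*2.+1 \in [pchar F] ->
  truncated_log (- 3%:R : F) n = truncated_log 1 n ->
  \sum_(1 <= j < n.+1)
      (- 3%:R) ^+ (n - j) * (((- 3%:R) ^+ j - 1) / j%:R) = q ->
  \sum_(1 <= k < n./2.+1) 1 / 4%:R ^+ k * 'C(4 * k, 2 * k)%:R *
     (2%:R * truncated_log 1 (2 * k) - truncated_log 1 k) =
  (-1) ^+ n * (q / 2%:R).
Proof.
move=> p_gt2 charF log3E <-.
have nz i : (0 < i <= n)%N -> i%:R != 0 :> F.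
  by move=> i_n; rewrite -(dvdn_pcharf charF) gtnNdvd //; lia.
have two_neq0 : 2%:R != 0 :> F by rewrite -(dvdn_pcharf charF) gtnNdvd.
have four_neq0 : 4%:R != 0 :> F by rewrite (natrM _ 2 2) mulf_neq0.
apply: (mulfI two_neq0).
(* C(4k, 2k) / 4^k becomes 4^k C(n, 2k), hence the choice x = 2; the added term [k = 0] is zero. *)
transitivity (2%:R * \sum_(0 <= k < n./2.+1) 'C(n, k.*2)%:R *
   ((2%:R ^+ 2) ^+ k * (2%:R * truncated_log 1 k.*2 - truncated_log (1 : F) k))).
  rewrite [in RHS]big_ltn // truncated_log0 mulr0 subrr !mulr0 add0r.
  congr (_ * _); rewrite !big_nat; apply: eq_bigr => k /= k_n.
  have -> : (4 * k = 2 * (2 * k))%N by rewrite mulnA.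
  rewrite (central_binomial_pchar charF) /= ?odd_double ?uphalf_double //; last lia.
  rewrite !mul2n -[k.*2]mul2n exprM sqrrN [(4%:R ^+ 2) ^+ k]exprAC expr2.
  have -> : 2%:R ^+ 2 = 4%:R :> F by ring.
  by rewrite mul1r !mulrA mulVf ?expf_neq0 // mul1r [_ ^+ k * _]mulrC.
rewrite sum_even_binomial_log // !sum_binomial_alt_log //.
(* The contribution of x = -2 is (-1)^n (L(1) - L(-3)), which vanishes by [log3E]. *)
rewrite [X in _ + X](_ : _ = 0) ?addr0; last first.
  transitivity ((-1) ^+ n * (truncated_log 1 n - truncated_log (- 3%:R : F) n)).
    rewrite /truncated_log -sumrB mulr_sumr !big_nat; apply: eq_bigr => j /= j_n.
    have -> : 1 - 2%:R = -1 :> F by ring.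
    have -> : 1 - - 2%:R = 3%:R :> F by ring.
    have -> : (-1) ^+ n = (-1) ^+ (n - j) * (-1) ^+ j :> F.
      by rewrite -exprD subnK //; lia.
    rewrite [(- 3%:R) ^+ j]exprNn expr1n.
    have s2 : ((-1) ^+ j) ^+ 2 = 1 :> F by rewrite sqrr_sign.
    by move: ((-1) ^+ j) s2 => s s2; ring: s2.
  by rewrite log3E subrr mulr0.
(* The contribution of x = 2 is, term by term, (-1)^n times the sum that defines [q]. *)
rewrite mulrCA [2%:R * _]mulrC divfK // mulr_sumr !big_nat.
apply: eq_bigr => j /= j_n.
have -> : 1 + 2%:R = 3%:R :> F by ring.
have -> : 1 - 2%:R = -1 :> F by ring.
have -> : (-1) ^+ n = (-1) ^+ (n - j) * (-1) ^+ j :> F.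
  by rewrite -exprD subnK //; lia.
rewrite [(- 3%:R) ^+ j]exprNn [(- 3%:R) ^+ (n - j)]exprNn.
have s2 : ((-1) ^+ j) ^+ 2 = 1 :> F by rewrite sqrr_sign.
have r2 : ((-1) ^+ (n - j)) ^+ 2 = 1 :> F by rewrite sqrr_sign.
by move: ((-1) ^+ j) s2 ((-1) ^+ (n - j)) r2 => s s2 r r2; ring: s2 r2.
Qed.

(** * Transfer to the rational congruences *)

Theorem theorem2 (p : nat) (p_prime : prime p) (p_ge5 : (5 <= p)%N) :
  let S1 : rat :=
    \sum_(0 <= k < ((p - 1) %/ 2).+1) 'C(2 * k, k)%:R * harmonic_number k in
  let S2 : rat :=
    \sum_(1 <= k < ((p - 1) %/ 4).+1)
      1 / 4%:R ^+ k * 'C(4 * k, 2 * k)%:R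
      * (2%:R * harmonic_number (2 * k) - harmonic_number k) in
  let q3 : rat := fermat_quotient p 3 in
  [/\ p = 1 %[mod 3] -> eqmodq p S1 (- q3),
      p = 2 %[mod 3] -> eqmodq p S1 q3,
      p = 1 %[mod 6] -> eqmodq p S2 (- (-1) ^+ ((p - 1) %/ 2) * (q3 / 2%:R))
    & p = 5 %[mod 6] -> eqmodq p S2 ((-1) ^+ ((p - 1) %/ 2) * (q3 / 2%:R))].
Proof.
move=> S1 S2 q3.
have p_odd : odd p by case/even_prime: p_prime p_ge5 => [->|].
have p3 : ~~ (3 %| p)%N by rewrite dvdn_prime2 //; lia.
have [n pE] : exists n, p = n.*2.+1 by exists p./2; lia.
have n3 : (n %% 3 != 1)%N by lia.
have halfE : ((p - 1) %/ 2 = n)%N by lia.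
have quarterE : ((p - 1) %/ 4 = n./2)%N by lia.
have charF : p \in [pchar 'F_p] := pchar_Fp p_prime.
rewrite /S1 /S2 halfE quarterE => {S1 S2}.
set S1 : rat := \sum_(_ <= _ < _) _; set S2 : rat := \sum_(_ <= _ < _) _.
have nz i : (0 < i < p)%N -> i%:R != 0 :> 'F_p.
  by move=> i_p; rewrite -(dvdn_pcharf charF) gtnNdvd //; lia.
have charF' := charF; rewrite {1}pE in charF'.
have [q [qE log3E sumE]] := fermat_quotient3_pchar charF' n3.
(* Since p = 2n + 1 is prime to 3, [e] is 0 when p = 1 and 1 when p = 2 modulo 3. One signed formula
   thus serves both classes until the final case split. *)
set e : nat := (n %% 3 == 2)%N in sumE.
have q3E : q3 = q%:~R.
  rewrite /q3 /fermat_quotient; have -> : p.-1 = (2 * n)%N by lia.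
  rewrite exprM -rmorphXn -rmorphXn -(rmorph1 (intmul 1)) -rmorphB /= qE -pE.
  by rewrite rmorphM rmorph_nat mulrC mulKf // pnatr_eq0; lia.
have q3_red : reduces q3 (q%:~R : 'F_p) by rewrite q3E; apply: reduces_int.
have sign_red (m : nat) : reduces ((-1) ^+ m) ((-1) ^+ m : 'F_p).
  exact/reducesX/reducesN/(reduces_nat _ 1).
have harm_red (k : nat) : (k < p)%N ->
    reduces (harmonic_number k) (truncated_log (1 : 'F_p) k).
  by move=> k_p; apply: reduces_harmonic_number => i i_k; apply: nz; lia.
have S1E : eqmodq p S1 (- ((-1) ^+ e * q3)).
  apply: (reduces_eqmodq charF); last exact/reducesN/reducesM/q3_red.
  rewrite -(sum_central_binomial_log charF' sumE); apply: reduces_sum => k k_n.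
  by apply: reducesM (reduces_nat _ _) (harm_red _ _); lia.
have S2E : eqmodq p S2 ((-1) ^+ n * ((- ((-1) ^+ e * q3)) / 2%:R)).
  apply: (reduces_eqmodq charF); last first.
    apply: reducesM (sign_red _) (reducesM (reducesN (reducesM _ q3_red)) _) => //.
    by apply: reducesV (reduces_nat _ _); apply: nz; lia.
  (* Here 2k is at most [n], so every harmonic number involved has denominators prime to [p]. *)
  rewrite -(sum_central_binomial4_log _ charF' log3E sumE); last by lia.
  apply: reduces_sum => k k_n; apply: reducesM.
    apply: reducesM (reduces_nat _ _); apply: reducesM; first exact: (reduces_nat _ 1).
    apply: reducesV; last exact/reducesX/reduces_nat.
    by rewrite expf_neq0 // nz //; lia.
  apply: reducesD; last by apply/reducesN/harm_red; lia.
  by apply: reducesM (reduces_nat _ _) (harm_red _ _); lia.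
split=> pm.
- by have e0 : e = 0%N by [rewrite /e; lia]; rewrite e0 mul1r in S1E.
- by have e1 : e = 1%N by [rewrite /e; lia]; rewrite e1 mulN1r opprK in S1E.
- have e0 : e = 0%N by rewrite /e; lia.
  by rewrite e0 mul1r !mulNr mulrN in S2E; rewrite mulNr.
- have e1 : e = 1%N by rewrite /e; lia.
  by rewrite e1 mulN1r opprK in S2E.
Qed.
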